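(* The set $E(\mathcal{C})$ of all essentially minimal homeomorphisms of $\mathcal{C}=2^{\mathbb{N}}$ is a $G_\delta$ subset of $\mathrm{Aut}(\mathcal{C})$, hence is a Polish space.
   Context: $\mathcal{C}=2^{\mathbb{N}}=\{0,1\}^{\mathbb{N}}$ has the product topology and metric $d_{\mathcal{C}}(x,y)=2^{-n}$ for $x\neq y$, where $n$ is least with $x(n)\ne y(n)$. $\mathrm{Aut}(\mathcal{C})$ is the set of all homeomorphisms $T:\mathcal{C}\to\mathcal{C}$ with the compact-open topology, equivalently the topology given by $d(T,S)=\sup\{d_{\mathcal{C}}(Tx,Sx): x\in\mathcal{C}\}$; it is a Polish space. $T\in\mathrm{Aut}(\mathcal{C})$ is essentially minimal if $(\mathcal{C},T)$ has a unique minimal set, i.e. a unique nonempty closed set $Y$ with $TY=Y$ that is minimal (under inclusion) among all such sets. *)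

(* Defs.v *)
From HB Require Import structures.
From mathcomp Require Import all_boot all_order all_algebra.
From mathcomp Require Import all_classical all_reals all_analysis.

Set Implicit Arguments.
Unset Strict Implicit.
Unset Printing Implicit Defensive.

Local Open Scope classical_set_scope.

Definition homeomorphism (X Y : topologicalType) (f : X -> Y) : Prop :=
  continuous f /\
  exists g : Y -> X, [/\ continuous g, cancel f g & cancel g f].

Definition separable (X : topologicalType) : Prop :=
  exists2 S : set X, countable S & dense S.

(* Completeness is the property [cauchy_cvg] of [completeType], which is not
   used directly because it also requires a distinguished point. *)
Definition completely_metrizable (R : realType) (X : topologicalType) : Prop :=
  exists (M : metricType R) (f : X -> M),
    homeomorphism f /\
    forall F : set_system M, ProperFilter F -> cauchy F -> exists l : M, F --> l.

Definition polish (R : realType) (X : topologicalType) : Prop :=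
  separable X /\ completely_metrizable R X.

(* The type [set_type (Aut X)], to which [Aut X] coerces, carries the topology
   induced by the compact-open topology. *)
Definition Aut (X : topologicalType) : set {compact-open, X -> X} :=
  [set f | homeomorphism (f : X -> X)].

Arguments Aut X : clear implicits.

Definition closed_invariant (X : topologicalType) (T : X -> X) (Y : set X)
    : Prop :=
  [/\ Y !=set0, closed Y & T @` Y = Y].

Definition minimal_set (X : topologicalType) (T : X -> X) (Y : set X) : Prop :=
  closed_invariant T Y /\
  forall Z : set X, closed_invariant T Z -> Z `<=` Y -> Z = Y.

Definition essentially_minimal (X : topologicalType) (T : X -> X) : Prop :=
  exists! Y : set X, minimal_set T Y.

Definition essentially_minimal_homeos (X : topologicalType) : set (Aut X) :=
  [set T : Aut X | essentially_minimal (set_val T : X -> X)].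

Arguments essentially_minimal_homeos X : clear implicits.

(* Main.v *)
From HB Require Import structures.
Require Import Defs.
From mathcomp Require Import all_boot all_order all_algebra.
From mathcomp Require Import all_classical all_reals all_analysis.
From mathcomp Require Import borel_hierarchy.

(* An ultrametric topology is described by its decreasing sequence of
   equivalence relations [e n].  By compactness, [T] is essentially minimal iff
   every two forward orbits come [e n]-close to each other for every [n]:
   every omega-limit set contains a minimal set, and conversely two disjoint
   closed invariant sets are separated at some level [n].  For fixed [n] this is
   an open condition on [T], by the tube lemma on the square of the space.

   On the group of homeomorphisms, uniform closeness of both [T] and its inverse
   defines a complete separable ultrametric, and a G_delta subset of such a
   space again carries one. *)

Set Implicit Arguments.
Unset Strict Implicit.
Unset Printing Implicit Defensive.

Import Order.TTheory GRing.Theory Num.Theory.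
Local Open Scope classical_set_scope.

(* [e n x y] stands for [d x y < 1/(n+1)] in a complete separable ultrametric. *)
Record ultra_base (X : topologicalType) (e : nat -> X -> set X) : Prop :=
  UltraBase {
  ub_refl : forall n x, e n x x;
  ub_sym : forall n x y, e n x y -> e n y x;
  ub_trans : forall n y x z, e n x y -> e n y z -> e n x z;
  ub_le : forall m n x y, m <= n -> e n x y -> e m x y;
  ub_sep : forall x y, (forall n, e n x y) -> x = y;
  ub_nbhsP : forall x A, nbhs x A <-> exists n, e n x `<=` A;
  ub_complete : forall u : nat -> X, (forall n, e n (u n) (u n.+1)) ->
    exists l, forall n, e n (u n) l;
  ub_countable : forall n, exists c : X -> nat,
    forall x y, c x = c y -> e n x y }.

(** * Separability and metrization *)

Section ultra_base_theory.
Context {X : topologicalType} {e : nat -> X -> set X}.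
Hypothesis eX : ultra_base e.

Lemma ub_nbhs n x : nbhs x (e n x).
Proof. by apply/(ub_nbhsP eX); exists n. Qed.

Lemma ub_separable : separable X.
Proof.
have [c cP] := choice (ub_countable eX).
(* [h n k] picks one representative of the code [k] at level [n], if that code is attained; these
   countably many points meet every class. *)
pose h n k : option X :=
  if pselect (exists x, c n x = k) is left ex then Some (sval (cid ex))
  else None.
have hP n x : exists2 y, h n (c n x) = Some y & c n y = c n x.
  rewrite /h; case: pselect => [ex|[]]; last by exists x.
  by case: cid => y /= cy; exists y.
exists (\bigcup_n [set x | h n (c n x) = Some x]).
  apply: bigcup_countable => // n _; apply/countable_injP; exists (c n) => x y.
  by rewrite !inE /= => hx hy cxy; move: hx; rewrite cxy hy => -[].
move=> O [x Ox] oO.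
have /(ub_nbhsP eX) [n nO] : nbhs x O by apply: open_nbhs_nbhs.
have [y hy cy] := hP n x.
by exists y; split; [apply/nO/cP|exists n => //=; rewrite cy].
Qed.

Let splits x y : x <> y -> exists n, `[< ~ e n x y >].
Proof.
move=> xy; apply: contrapT => /forallNP ne; apply/xy/(ub_sep eX) => n.
by apply: contrapT => nexy; apply: (ne n); apply/asboolP.
Qed.

Let dist {R : realType} (x y : X) : R :=
  (if pselect (x = y) is right xy then (ex_minn (splits xy)).+1%:R^-1 else 0)%R.

Let distP {R : realType} n x y : (dist x y < n.+1%:R^-1 :> R)%R <-> e n x y.
Proof.
rewrite /dist; case: pselect => [->|xy].
  by split=> // _; exact: ub_refl eX _ _.
case: ex_minnP => m /asboolP nem mmin; rewrite ltf_pV2 ?posrE // ltr_nat ltnS.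
split=> [nm|enxy]; last by rewrite ltnNge; apply/negP => /(ub_le eX)/(_ enxy).
by apply: contrapT => /asboolP/mmin; rewrite leqNgt nm.
Qed.

Let dist_ge0 {R : realType} x y : (0 <= dist x y :> R)%R.
Proof. by rewrite /dist; case: pselect. Qed.

Let dist_xx {R : realType} x : dist x x = 0%R :> R.
Proof. by rewrite /dist; case: pselect. Qed.

Let dist_pos {R : realType} x y : dist x y = 0%R :> R -> x = y.
Proof. by move=> d0; apply: (ub_sep eX) => n; apply/(@distP R); rewrite d0. Qed.

(** A distance above [r] is [1/(m+1)] with [m] a level separating [x] and [y], which the hypothesis
    at [m] excludes. Symmetry and the triangle inequality thereby reduce to the laws of [e n]. *)
Let dist_levels {R : realType} (x y : X) (r : R) : (0 <= r)%R ->
  (forall n, r < n.+1%:R^-1 -> e n x y)%R -> (dist x y <= r)%R.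
Proof.
move=> r0 rP; rewrite leNgt; apply/negP; rewrite {1}/dist.
case: pselect => [_|xy]; first by rewrite ltNge r0.
by case: ex_minnP => m /asboolP nem _ /rP.
Qed.

Let dist_sym {R : realType} x y : dist x y = dist y x :> R.
Proof.
by apply/eqP; rewrite eq_le !dist_levels ?dist_ge0 // => n /distP /(ub_sym eX).
Qed.

Let dist_triangle {R : realType} y x z :
  (dist x z <= dist x y + dist y z :> R)%R.
Proof.
apply: dist_levels => [|n dn].
  exact: addr_ge0 (dist_ge0 _ _) (dist_ge0 _ _).
by apply: (ub_trans eX (y := y)); apply/(@distP R); apply: le_lt_trans dn;
  rewrite ?lerDl ?lerDr dist_ge0.
Qed.

(** The vacuous [let] makes this alias of [X] carry the proof [eX], from which the metric instance
    is built. *)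
Definition ultra_space (R : realType) : Type := let _ := eX in X.
HB.instance Definition _ (R : realType) := Choice.on (ultra_space R).
HB.instance Definition _ (R : realType) :=
  @isMetric.Build R (ultra_space R)
    dist dist_xx dist_pos dist_sym dist_triangle.

Lemma mdist_ultra (R : realType) n (x y : ultra_space R) :
  (mdist x y < n.+1%:R^-1)%R <-> e n x y.
Proof. exact: distP. Qed.

End ultra_base_theory.

(** A Cauchy filter contains a class of every level. Classes of consecutive levels meet, so their
    centres form a sequence to which [ub_complete] applies. *)
Lemma ub_polish (R : realType) (X : topologicalType) (e : nat -> X -> set X) :
  ultra_base e -> polish R X.
Proof.
move=> eX; split; first exact: ub_separable eX.
pose M : metricType R := ultra_space eX R.
have ballE (x : M) n : ball x (n.+1%:R^-1 : R)%R = e n x.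
  by rewrite ballEmdist; apply/seteqP; split=> y /mdist_ultra.
have invn_gt0 n : (0 < n.+1%:R^-1 :> R)%R by rewrite invr_gt0.
have nbhs_base (x : M) A : nbhs x A <-> exists n, e n x `<=` A.
  split=> [/nbhs_ballP[r /= r0 rA]|[n nA]].
    have [n nr] := ltr_add_invr r0; exists n; apply: subset_trans rA.
    by rewrite -ballE; apply: le_ball; rewrite -[leLHS]add0r ltW.
  by apply: (@filterS M) nA _; rewrite -ballE; exact: nbhsx_ballx.
exists M, id; split; first split.
- by move=> x A /nbhs_base/(ub_nbhsP eX).
- by exists id; split=> // x A /(ub_nbhsP eX)/nbhs_base.
move=> F FF /cauchy_ballP Fc.
have FE n : exists x : M, F (e n x).
  have [[A B] /= [FA FB] AB] := Fc _ (invn_gt0 n).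
  have [x Ax] := filter_ex FA; exists x; apply: filterS FB => y By.
  by rewrite -ballE; apply: (AB (x, y)).
have [u uP] := choice FE.
have [|l lP] := ub_complete eX (u := u).
  move=> n; have [x [xn xSn]] := filter_ex (filterI (uP n) (uP n.+1)).
  apply: (ub_trans eX) xn _; apply: (ub_sym eX).
  exact: (ub_le eX) (leqnSn n) xSn.
exists l => A /nbhs_base[n nA]; apply: filterS (uP n) => x ux.
by apply: nA; apply: (ub_trans eX) (ub_sym eX (lP n)) ux.
Qed.

(** * G_delta subsets *)

Section ultra_base_Gdelta.
Context {X : topologicalType} {e : nat -> X -> set X} {A : set X}.
Hypotheses (eX : ultra_base e) (GA : Gdelta A).

(* Alexandroff's remetrization, discretized: besides [e n], compare the least
   levels at which the classes of the two points enter the open sets. *)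
Lemma ub_Gdelta : exists e' : nat -> A -> set A, ultra_base e'.
Proof.
have [F oF AE] := GA.
have AF x : A x <-> forall k, F k x.
  by rewrite AE; split=> [Fx k|Fx k _]; apply: Fx.
have rex k (x : A) : exists m, `[< e m (set_val x) `<=` F k >].
  have /AF/(_ k) Fx : A (set_val x) by apply: set_valP.
  have /(ub_nbhsP eX)[m mF] : nbhs (set_val x) (F k).
    by apply: open_nbhs_nbhs.
  by exists m; apply/asboolP.
pose r k x := ex_minn (rex k x).
have rF k x : e (r k x) (set_val x) `<=` F k.
  by rewrite /r; case: ex_minnP => m /asboolP.
have rmin k x m : e m (set_val x) `<=` F k -> r k x <= m.
  by move=> mF; rewrite /r; case: ex_minnP => p _; apply; apply/asboolP.
have rle k x y : e (r k x) (set_val x) (set_val y) -> r k y <= r k x.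
  by move=> xy; apply: rmin => z yz; apply/rF/(ub_trans eX xy).
(* Hence [r k] is locally constant: [rle] gives one inequality, which makes the hypothesis symmetric
   and gives the other. *)
have r_loc k x y : e (r k x) (set_val x) (set_val y) -> r k x = r k y.
  move=> xy; apply/eqP; rewrite eqn_leq (rle k x y xy) andbT.
  apply: (rle k y x).
  exact: (ub_le eX) (rle _ _ _ xy) (ub_sym eX xy).
(* Only the ranks [k < n] are compared at level [n]: finitely many, so that the new classes remain
   neighbourhoods. *)
exists (fun n x => [set y | e n (set_val x) (set_val y) /\
  forall k, k < n -> r k x = r k y]); split.
- by move=> n x; split=> //; apply: ub_refl eX _ _.
- by move=> n x y [xy rxy]; split=> [|k /rxy//]; apply: ub_sym eX _ _ _ xy.
- move=> n y x z [xy rxy] [yz ryz]; split.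
    exact: ub_trans eX _ _ _ _ xy yz.
  by move=> k kn; rewrite rxy // ryz.
- move=> m n x y mn [xy rxy]; split; first exact: ub_le eX _ _ _ _ mn xy.
  by move=> k km; apply: rxy; apply: leq_trans mn.
- by move=> x y xy; apply/val_inj/(ub_sep eX) => n; have [] := xy n.
- move=> x B; split=> [[_ [[C oC <-] Cx CB]]|[n nB]].
    have /(ub_nbhsP eX)[n nC] : nbhs (set_val x) C by apply: open_nbhs_nbhs.
    by exists n => y [xy _]; apply/CB/nC.
  apply: filterS nB _.
  have nbhs_e m : nbhs x [set y : A | e m (set_val x) (set_val y)].
    exact: (initial_continuous (f := set_val) (ub_nbhs eX m _)).
  pose N := maxn n (\max_(k < n) r k x).
  apply: filterS (nbhs_e N) => y xy; split.
    exact: (ub_le eX) (leq_maxl _ _) xy.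
  move=> k kn; apply: r_loc; apply: (ub_le eX) xy.
  by rewrite leq_max; apply/orP; right; apply: (leq_bigmax (Ordinal kn)).
- move=> u uP.
  have [n|l lP] := ub_complete eX (u := set_val \o u); first by have [] := uP n.
  (* Rank [k] is controlled only from level [k.+1] on; from there it is frozen along the
     sequence. *)
  have ru k m n : k < m -> m <= n -> r k (u m) = r k (u n).
    move=> km /subnK <-; elim: (n - m) => // i ->; rewrite addSn.
    by have [_] := uP (i + m); apply; apply: leq_trans km (leq_addl _ _).
  have Al : A l.
    apply/AF => k; pose m := maxn k.+1 (r k (u k.+1)).
    have km : k < m by apply: leq_maxl.
    apply: (rF k (u m)); apply: (ub_le eX) (lP m).
    by rewrite -(ru k k.+1 m) ?leq_maxr.
  exists (exist _ l (mem_set Al)) => n; split; first exact: lP.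
  move=> k kn; pose m := maxn n (r k (u n)).
  rewrite (ru _ _ m kn) ?leq_maxl //; apply: r_loc; apply: (ub_le eX) (lP m).
  by rewrite -(ru _ _ _ kn) ?leq_maxl ?leq_maxr.
- move=> n; have [c cP] := ub_countable eX n.
  exists (fun x => pickle (c (set_val x), [seq r k x | k <- iota 0 n])).
  move=> x y /(pcan_inj pickleK)[/cP xy /eq_in_map rxy]; split=> // k kn.
  by apply: rxy; rewrite mem_iota.
Qed.

End ultra_base_Gdelta.

(** * Homeomorphism groups of compact ultrametric spaces *)

(** Tube lemma in filter form; the parameter [i] will be a level, a finite list or a
    homeomorphism. *)
Lemma compact_near_forall (X : topologicalType) (I : Type) (F : set_system I)
    (P : I -> X -> Prop) : compact [set: X] -> Filter F ->
  (forall x : X, \forall y \near x & i \near F, P i y) ->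
  \forall i \near F, forall x, P i x.
Proof.
move=> /compact_near_coveringP cX FF nP.
by apply: filterS (cX _ F P FF (fun x _ => nP x)) => i Pi x; apply: Pi.
Qed.

Section compact_ultra_base.
Context {X : topologicalType} {e : nat -> X -> set X}.
Hypotheses (eX : ultra_base e) (cX : compact [set: X]).

Lemma ub_clopen n x : clopen (e n x).
Proof.
split.
  rewrite openE => y xy; apply/(ub_nbhsP eX); exists n => z yz.
  exact: ub_trans eX _ _ _ _ xy yz.
move=> y /(_ _ (ub_nbhs eX n y))[z [xz yz]].
exact: ub_trans eX _ _ _ _ xz (ub_sym eX yz).
Qed.

Lemma ub_unif_continuous (f : X -> X) : continuous f ->
  forall n, exists m, forall x y, e m x y -> e n (f x) (f y).
Proof.
move=> fc n.
have : \forall m \near \oo, forall x, e m x `<=` e n (f x) \o f.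
  apply: compact_near_forall => // x.
  have /(ub_nbhsP eX)[m mf] := fc x _ (ub_nbhs eX n (f x)).
  exists (e m x, [set k | m <= k]); first by split; [exact: ub_nbhs|exists m].
  move=> [y k] /= [xy mk] z yz; apply: (ub_trans eX (y := f x)).
    by apply: (ub_sym eX); apply: mf.
  by apply: mf; apply: (ub_trans eX) xy (ub_le eX mk yz).
by move=> [m _ /(_ m (leqnn m)) mP]; exists m => x y; apply: mP.
Qed.

Lemma ub_finite_net n :
  exists s : seq X, forall x, exists2 y, y \in s & e n x y.
Proof.
(* Finite lists directed by inclusion: a property true near [F] holds of some finite list, which
   turns the tube lemma into the extraction of a finite subcover. *)
pose F := filter_from setT (fun s : seq X => [set t : seq X | {subset s <= t}]).
have FF : ProperFilter F.
  apply: filter_from_proper => [|s _]; last by exists s.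
  apply: filter_from_filter => [|s t _ _]; first by exists [::].
  exists (s ++ t) => // w stw; split=> x xs; apply: stw; rewrite mem_cat xs //.
  by rewrite orbT.
have : \forall t \near F, forall x, exists2 y, y \in t & e n x y.
  apply: compact_near_forall => // x.
  exists (e n x, [set t : seq X | {subset [:: x] <= t}]).
    by split; [exact: ub_nbhs|exists [:: x]].
  move=> [y t] /= [xy xt]; exists x; first by apply: xt; rewrite mem_seq1.
  exact: ub_sym eX _ _ _ xy.
exact: filter_ex.
Qed.

(** A continuous map is determined up to level [n] by a modulus of uniform continuity and by the
    codes of its values on a finite net for that modulus. *)
Lemma ub_continuous_countable n : exists c : (X -> X) -> nat,
  forall f g, continuous f -> continuous g -> c f = c g ->
  forall x, e n (f x) (g x).
Proof.
have [s sP] := choice ub_finite_net.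
have [c cP] := ub_countable eX n.
have muE (f : X -> X) : exists m, continuous f ->
    forall x y, e m x y -> e n (f x) (f y).
  have [/ub_unif_continuous/(_ n)[m mP]|ncf] := pselect (continuous f).
    by exists m.
  by exists 0.
have [mu muP] := choice muE.
exists (fun f => pickle (mu f, [seq c (f y) | y <- s (mu f)])) => f g fc gc.
move=> /(pcan_inj pickleK)[mufg]; rewrite -mufg => /eq_in_map fg x.
have [y ys xy] := sP (mu f) x.
apply: (ub_trans eX) (muP f fc x y xy) _.
apply: (ub_trans eX) (cP _ _ (fg y ys)) _.
by apply: (muP g gc); rewrite -mufg; apply: ub_sym eX _ _ _ xy.
Qed.

End compact_ultra_base.

(** * The homeomorphism group *)

Definition Aut_fun (X : topologicalType) (T : Aut X) : X -> X := set_val T.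

Definition Aut_inv (X : topologicalType) (T : Aut X) : X -> X :=
  sval (cid (set_valP T).2).

Lemma Aut_continuous (X : topologicalType) (T : Aut X) :
  continuous (Aut_fun T).
Proof. exact: (set_valP T).1. Qed.

Lemma Aut_inv_continuous (X : topologicalType) (T : Aut X) :
  continuous (Aut_inv T).
Proof. by rewrite /Aut_inv; case: cid => g []. Qed.

Lemma Aut_invK (X : topologicalType) (T : Aut X) :
  cancel (Aut_fun T) (Aut_inv T).
Proof. by rewrite /Aut_inv; case: cid => g []. Qed.

Lemma Aut_invKV (X : topologicalType) (T : Aut X) :
  cancel (Aut_inv T) (Aut_fun T).
Proof. by rewrite /Aut_inv; case: cid => g []. Qed.

Section Aut_ultra_base.
Context {X : topologicalType} {e : nat -> X -> set X}.
Hypotheses (eX : ultra_base e) (cX : compact [set: X]).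

(** Joint continuity of evaluation: classes are clopen, so [e m x] is compact and [K] is a subbasic
    open set of the compact-open topology. *)
Lemma near_Aut_eval (T : Aut X) x n :
  \forall S \near T & y \near x,
    e n (Aut_fun T x) (Aut_fun S y).
Proof.
have /(ub_nbhsP eX)[m mT] := Aut_continuous (ub_nbhs eX n (set_val T x)).
pose K := [set g : {compact-open, X -> X} | g @` e m x `<=` e n (Aut_fun T x)].
have oK : open K.
  apply: compact_open_open; last by have [] := ub_clopen eX n (set_val T x).
  apply: (subclosed_compact _ cX) => //.
  by have [] := ub_clopen eX m x.
exists ([set S : Aut X | K (set_val S)], e m x).
  split=> /=; last exact: ub_nbhs.
  apply: (initial_continuous (f := set_val)); apply: open_nbhs_nbhs.
  by split=> // _ [y xy <-]; apply: mT.
by move=> [S y] /= [KS xy]; apply: KS; exists y.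
Qed.

Lemma near_Aut_unif (T : Aut X) n :
  \forall S \near T, forall x,
    e n (Aut_fun T x) (Aut_fun S x).
Proof.
apply: (compact_near_forall (F := nbhs T)) => // x.
have [[A B] /= [TA xB] AB] := near_Aut_eval T x n.
exists (B `&` (e n (Aut_fun T x) \o Aut_fun T), A).
  split=> //=; apply: filterI => //.
  exact: Aut_continuous (ub_nbhs eX n (set_val T x)).
move=> [y S] /= [[By xy] AS]; apply: (ub_trans eX (ub_sym eX xy)).
exact: (AB (S, y)).
Qed.

Lemma near_Aut_inv_unif (T : Aut X) n :
  \forall S \near T, forall x, e n (Aut_inv T x) (Aut_inv S x).
Proof.
have [m mT] := ub_unif_continuous eX cX (Aut_inv_continuous (T := T)) n.
(* With [y = Aut_inv S x], the points [T y] and [S y = x] are close at level [m]; applying the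
   inverse of [T] brings [y] and [Aut_inv T x] close at level [n]. *)
apply: filterS (near_Aut_unif T m) => S TS x.
apply: (ub_sym eX); rewrite -[X in e n X](Aut_invK T).
by apply: mT; rewrite -[X in e m _ X](Aut_invKV S); apply: TS.
Qed.

Lemma ub_unif_limit (u : nat -> X -> X) :
  (forall n x, e n (u n x) (u n.+1 x)) -> (forall n, continuous (u n)) ->
  exists2 f, continuous f & forall n x, e n (u n x) (f x).
Proof.
move=> ue uc.
have [f fP] := choice (fun x => ub_complete eX (u := u^~ x) (ue^~ x)).
exists f => // x A /(ub_nbhsP eX)[n nA].
have unx : nbhs x (u n @^-1` e n (u n x)) by apply: uc; apply: ub_nbhs.
apply: (@filterS _ (nbhs x) _ _ _ _ unx) => y xy.
apply: nA; apply: (ub_trans eX (ub_sym eX (fP x n))).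
exact: (ub_trans eX) xy (fP y n).
Qed.

(** A uniform limit of homeomorphisms may fail to be injective. Controlling the inverses too
    supplies an inverse of the limit, and [near_Aut_inv_unif] shows that the topology does not
    change. *)
Lemma ub_Aut : ultra_base (fun n (T : Aut X) => [set S : Aut X | forall x,
  e n (Aut_fun T x) (Aut_fun S x) /\
  e n (Aut_inv T x) (Aut_inv S x)]).
Proof.
split.
- by move=> n T x; split; apply: ub_refl eX _ _.
- by move=> n S T ST x; have [] := ST x; split; apply: (ub_sym eX).
- move=> n S T U TS SU x; have [? ?] := TS x; have [? ?] := SU x.
  by split; apply: (ub_trans eX); eassumption.
- move=> m n S T mn ST x; have [? ?] := ST x.
  by split; apply: (ub_le eX mn).
- move=> S T ST; apply: val_inj; apply/funext => x.
  by apply: (ub_sep eX) => n; have [] := ST n x.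
- move=> T B; split=> [[_ [[C oC <-] CT CB]]|[n nB]]; last first.
    apply: filterS nB _; have := near_Aut_inv_unif T n.
    apply: filter_app; have := near_Aut_unif T n.
    by apply: filterS => S TS TS' x.
  (* [F] is generated by the uniform neighbourhoods of [T]. Its convergence to [T] puts one of them
     inside any compact-open neighbourhood. *)
  pose F := filter_from [set: nat] (fun n => [set f : {compact-open, X -> X} |
    forall x, e n (Aut_fun T x) (f x)]).
  have FF : Filter F.
    apply: filter_from_filter; first by exists 0.
    move=> m n _ _; exists (maxn m n) => // f Tf.
    by split=> x; apply: (ub_le eX) (Tf x); rewrite (leq_maxl, leq_maxr).
  have : F C.
    suff FT : F --> (set_val T : {compact-open, X -> X}).
      by apply: FT; apply: open_nbhs_nbhs.
    apply/compact_open_cvgP => K O cK oO KO.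
    have : \forall n \near \oo,
        K `<=` [set x | e n (Aut_fun T x) `<=` O].
      apply: (iffLR (compact_near_coveringP _) cK) => x Kx.
      have : nbhs (Aut_fun T x) O.
        by apply: open_nbhs_nbhs; split=> //; apply: KO; exists x.
      move=> /(ub_nbhsP eX)[n nO].
      exists (e n (Aut_fun T x) \o Aut_fun T, [set k | n <= k]).
        split; last by exists n.
        exact: Aut_continuous (ub_nbhs eX n (set_val T x)).
      move=> [y k] /= [xy nk] z yz; apply: nO; apply: (ub_trans eX) xy _.
      exact: (ub_le eX) nk yz.
    move=> [n _ /(_ n (leqnn n)) nO]; exists n => // f Tf _ [x Kx <-].
    exact: nO Kx _ (Tf x).
  by move=> [n _ nC]; exists n => S TS; apply/CB/nC => x; have [] := TS x.
- move=> u uP.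
  have [f fc fP] := ub_unif_limit (fun n x => (uP n x).1)
    (fun n => Aut_continuous (T := u n)).
  have [g gc gP] := ub_unif_limit (fun n x => (uP n x).2)
    (fun n => Aut_inv_continuous (T := u n)).
  have fgK (f' g' : X -> X) (v w : nat -> X -> X) :
      continuous g' -> (forall n, cancel (v n) (w n)) ->
      (forall n x, e n (v n x) (f' x)) -> (forall n x, e n (w n x) (g' x)) ->
      cancel f' g'.
    move=> g'c vwK f'P g'P x; apply: (ub_sep eX) => n.
    have /(ub_nbhsP eX)[m mg] := g'c (f' x) _ (ub_nbhs eX n (g' (f' x))).
    (* [m] serves the continuity of [g'] at [f' x], and [n] the closeness of [w k] to [g']. *)
    pose k := maxn m n.
    have /mg g'v : e m (f' x) (v k x).
      by apply: (ub_le eX) (ub_sym eX (f'P k x)); apply: leq_maxl.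
    apply: (ub_trans eX) g'v _; rewrite -{2}(vwK k x).
    by apply: (ub_le eX) (ub_sym eX (g'P k _)); apply: leq_maxr.
  have fA : Aut X (f : {compact-open, X -> X}).
    split=> //; exists g; split=> //.
      by apply: (fgK _ _ _ _ gc) fP gP => n; apply: Aut_invK.
    by apply: (fgK _ _ _ _ fc) gP fP => n; apply: Aut_invKV.
  pose l : Aut X := exist (fun h => h \in Aut X) _ (mem_set fA).
  exists l => n x; split; first exact: fP.
  (* [Aut_inv l] is a chosen inverse, identified with [g] by uniqueness of inverses. *)
  have -> : Aut_inv l x = g x; last exact: gP.
  have gfK : cancel g f by apply: (fgK _ _ _ _ fc) gP fP => k; apply: Aut_invKV.
  have : Aut_inv l (f (g x)) = g x := Aut_invK l (g x).
  by rewrite gfK.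
- move=> n; have [c cP] := ub_continuous_countable eX cX n.
  exists (fun T => pickle (c (Aut_fun T), c (Aut_inv T))).
  move=> S T /(pcan_inj pickleK)[STc STc'] x.
  split; apply: cP => //;
    first [exact: Aut_continuous|exact: Aut_inv_continuous].
Qed.

End Aut_ultra_base.

(** * Essential minimality *)

Section compact_dynamics.
Context {X : topologicalType} {T : X -> X}.
Hypotheses (cX : compact [set: X]) (hT : homeomorphism T).

(** By bijectivity invariance can be tested pointwise, a form that passes to arbitrary
    intersections. *)
Lemma invariantE (Y : set X) : T @` Y = Y <-> forall x, Y (T x) <-> Y x.
Proof.
have [_ [g [_ TK gK]]] := hT; split=> [TY x|TY].
  split=> [|Yx]; last by rewrite -TY; exists x.
  by rewrite -{1}TY => -[y Yy /(can_inj TK) <-].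
apply/seteqP; split=> [_ [x Yx <-]|x Yx]; first exact/TY.
by exists (g x); rewrite ?gK //; apply/TY; rewrite gK.
Qed.

Lemma closed_invariant_iter (Y : set X) x n :
  closed_invariant T Y -> Y x -> Y (iter n T x).
Proof.
by move=> [_ _ /invariantE TY] Yx; elim: n => // n IH; apply/TY.
Qed.

Lemma closed_invariant_bigcap (D : set (set X)) :
  (forall Y, D Y -> closed_invariant T Y) -> \bigcap_(Y in D) Y !=set0 ->
  closed_invariant T (\bigcap_(Y in D) Y).
Proof.
move=> DT D0; split=> //; first by apply: closed_bigI => Y /DT[].
apply/invariantE => x; split=> Dx Y DY; have [_ _ /invariantE TY] := DT _ DY;
  by apply/TY; apply: Dx.
Qed.

(** Zorn's lemma for reverse inclusion. The members of a nonempty chain generate a proper filter,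
    and by compactness its cluster point lies in their intersection. *)
Lemma exists_minimal_set (Z : set X) : closed_invariant T Z ->
  exists2 Y, minimal_set T Y & Y `<=` Z.
Proof.
move=> ZT; pose P Y := closed_invariant T Y /\ Y `<=` Z.
pose S := {Y : set X | P Y}.
pose R (Y W : S) := `[< sval W `<=` sval Y >].
pose Z0 : S := exist P Z (conj ZT (@subset_refl _ Z)).
have [||C Ctot|[Y [YT YZ]] Ymin] := @ZL_preorder S Z0 R.
- by move=> Y; apply/asboolP.
- move=> Y W V /asboolP YW /asboolP VY; apply/asboolP.
  exact: subset_trans VY YW.
- have [[W CW]|C0] := pselect (C !=set0); last first.
    by exists Z0 => Y CY; case: C0; exists Y.
  pose F := filter_from C (fun Y => sval Y).
  have FF : ProperFilter F.
    apply: filter_from_proper => [|Y _]; last by have [[]] := svalP Y.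
    apply: filter_from_filter; first by exists W.
    move=> Y V CY CV; have [/asboolP YV|/asboolP VY] := Ctot _ _ CY CV.
      by exists V => // x Vx; split=> //; apply: YV.
    by exists Y => // x Yx; split=> //; apply: VY.
  have [x [_ Fx]] : [set: X] `&` cluster F !=set0 by apply: cX; exists W.
  have CT : closed_invariant T (\bigcap_(Y in sval @` C) Y).
    apply: closed_invariant_bigcap => [_ [Y _ <-]|].
      by have [] := svalP Y.
    exists x => _ [Y CY <-]; have [[_ cY _] _] := svalP Y.
    by apply: cY => B xB; apply: Fx => //; exists Y.
  have CZ : \bigcap_(Y in sval @` C) Y `<=` Z.
    by move=> y Cy; have [_] := svalP W; apply; apply: Cy; exists W.
  exists (exist P _ (conj CT CZ)) => Y CY; apply/asboolP => y; apply.
  by exists Y.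
exists Y => //; split=> // W WT WY.
have WZ := subset_trans WY YZ.
apply/seteqP; split=> //.
by have /asboolP := Ymin (exist P W (conj WT WZ)) (introT (asboolP _) WY).
Qed.

Definition omega_limit (x : X) : set X :=
  [set z | forall A, nbhs z A -> forall N, exists2 n, N <= n & A (iter n T x)].

Lemma omega_limit_closed_invariant x : closed_invariant T (omega_limit x).
Proof.
have [Tc [g [gc TK gK]]] := hT; split.
- pose F := (fun n => iter n T x) @ \oo.
  have [z [_ zF]] : [set: X] `&` cluster F !=set0.
    by apply: cX; apply: filterT.
  exists z => A zA N.
  have FN : F [set y | exists2 n, N <= n & y = iter n T x].
    by exists N => // n /= Nn; exists n.
  by have [_ [[n Nn ->] An]] := zF _ _ FN zA; exists n.
- move=> z zw A zA; have [y [yw yA]] := zw _ (nbhs_interior zA).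
  exact: yw yA.
- apply/invariantE => z; split=> zw A zA N.
    (* Pulling back along [g] loses one iterate; asking for an index at least [N.+1] leaves one at
       least [N] and rules out index 0. *)
    have gz : nbhs (T z) (g @^-1` A) by apply: gc; rewrite TK.
    by have [[|n] //= Nn] := zw _ gz N.+1; rewrite TK; exists n.
  by have [n Nn nA] := zw _ (Tc _ _ zA) N; exists n.+1 => //; apply: leqW.
Qed.

Lemma essentially_minimalE (e : nat -> X -> set X) : ultra_base e -> X ->
  essentially_minimal T <->
  forall n x y, exists i j, e n (iter i T x) (iter j T y).
Proof.
move=> eX x0; split=> [[Y [[[[z Yz] _ _] _] Yuniq]] n x y|eT].
  (* Both orbits approach the same point [z]: each omega-limit set contains a minimal set, which can
     only be [Y]. *)
  have Yw w : exists i, e n (iter i T w) z.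
    have [W Wmin Ww] := exists_minimal_set (omega_limit_closed_invariant w).
    have zw : omega_limit w z by apply: Ww; rewrite -(Yuniq W Wmin).
    have [i _ zi] := zw _ (ub_nbhs eX n z) 0.
    by exists i; apply: (ub_sym eX).
  have [[i xi] [j yj]] := (Yw x, Yw y).
  by exists i, j; apply: (ub_trans eX) xi (ub_sym eX yj).
have TT : closed_invariant T setT.
  by split; [exists x0|exact: closedT|apply/invariantE].
have [Y Ymin _] := exists_minimal_set TT.
exists Y; split=> // W Wmin.
have [[YT Ysub] [WT Wsub]] := (Ymin, Wmin).
(* Two minimal sets that meet coincide, both being equal to their intersection. *)
suff YW0 : Y `&` W !=set0.
  have YWT : closed_invariant T (Y `&` W).
    have [_ cY /invariantE TY] := YT; have [_ cW /invariantE TW] := WT.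
    split=> //; first exact: closedI.
    by apply/invariantE => x; rewrite /setI /= TY TW.
  by rewrite -(Ysub _ YWT (@subIsetl _ _ _)) {1}(Wsub _ YWT (@subIsetr _ _ _)).
have [[x Yx] cY _] := YT; have [[y Wy] cW _] := WT.
have [u uP] := choice (fun n => eT n x y).
have [v vP] := choice uP.
(* [a n] lies in [Y] and within level [n] of a point of [W], so a cluster point of [a] lies in both
   closed sets. *)
pose a n := iter (u n) T x.
have [z [_ za]] : [set: X] `&` cluster (a @ \oo) !=set0.
  by apply: cX; apply: filterT.
have aN N : (a @ \oo) [set p | exists2 n, N <= n & p = a n].
  by exists N => // n /= Nn; exists n.
exists z; split.
  apply: cY => B zB; have [_ [[n _ ->] Bn]] := za _ _ (aN 0) zB.
  by exists (a n); split=> //; apply: closed_invariant_iter.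
apply: cW => B /(ub_nbhsP eX)[N NB].
have [_ [[n Nn ->] zn]] := za _ _ (aN N) (ub_nbhs eX N z).
exists (iter (v n) T y); split; first exact: closed_invariant_iter.
by apply: NB; apply: (ub_trans eX) zn (ub_le eX Nn (vP n)).
Qed.

End compact_dynamics.

(** * The G_delta condition *)

Section essentially_minimal_Gdelta.
Context {X : topologicalType} {e : nat -> X -> set X}.
Hypotheses (eX : ultra_base e) (cX : compact [set: X]).

Lemma Aut_iter_continuous i :
  continuous (fun p : Aut X * X => iter i (Aut_fun p.1) p.2).
Proof.
elim: i => [|i IH] [T x]; first exact: cvg_snd.
move=> A /(ub_nbhsP eX)[n nA].
have [[B C] /= [TB xC] BC] := near_Aut_eval eX cX T (iter i (Aut_fun T) x) n.
have [[B' C'] /= [TB' xC'] BC'] := IH (T, x) _ xC.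
exists (B `&` B', C') => [|[S y] /= [[BS BS'] Cy]].
  by split=> //; apply: filterI.
by apply: nA; apply: (BC (S, _)); split=> //; apply: (BC' (S, y)).
Qed.

Lemma essentially_minimal_homeos_Gdelta :
  X -> Gdelta (essentially_minimal_homeos X).
Proof.
move=> x0.
exists (fun n => [set T : Aut X | forall p : X * X, exists i j,
  e n (iter i (Aut_fun T) p.1) (iter j (Aut_fun T) p.2)]); last first.
  apply/seteqP; split=> T /=.
    move=> /(essentially_minimalE cX (set_valP T) eX x0) eT n _ [x y].
    exact: eT.
  move=> TF; apply/(essentially_minimalE cX (set_valP T) eX x0) => n x y.
  exact: (TF n I (x, y)).
move=> n; rewrite openE => T Tn.
have cXX : compact [set: X * X] by rewrite -setXTT; apply: compact_setX.
apply: (compact_near_forall (F := nbhs T)) => // -[x y].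
(* The times [i] and [j] found for [T] at [(x, y)] still work for nearby maps and nearby pairs. *)
have [i [j /= xy]] := Tn (x, y).
have [[B C] /= [TB xC] BC] :=
  @Aut_iter_continuous i (T, x) _ (ub_nbhs eX n (iter i (Aut_fun T) x)).
have [[B' C'] /= [TB' yC'] BC'] :=
  @Aut_iter_continuous j (T, y) _ (ub_nbhs eX n (iter j (Aut_fun T) y)).
exists (C `*` C', B `&` B').
  by split; [exists (C, C')|apply: filterI].
move=> [[x' y'] S] /= [[Cx' Cy'] [BS BS']]; exists i, j.
apply: (ub_trans eX) (ub_sym eX (BC (S, x') _)) _ => //.
by apply: (ub_trans eX) xy (BC' (S, y') _).
Qed.

End essentially_minimal_Gdelta.

(** * The Cantor space *)

Lemma cantor_ultra_base :
  ultra_base (fun n (x : cantor_space) =>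
    [set y : cantor_space | forall i, i < n -> x i = y i]).
Proof.
split.
- by [].
- by move=> n x y xy i /xy.
- by move=> n y x z xy yz i ni; rewrite xy // yz.
- by move=> m n x y mn xy i im; apply: xy; apply: leq_trans mn.
- by move=> x y xy; apply/funext => i; apply: (xy i.+1).
- move=> x A; split=> [xA|[n nA]].
    pose F := filter_from [set: nat]
      (fun n => [set y : cantor_space | forall i, i < n -> x i = y i]).
    have FF : Filter F.
      apply: filter_from_filter; first by exists 0.
      move=> m n _ _; exists (maxn m n) => // y xy.
      by split=> i im; apply: xy; rewrite leq_max im ?orbT.
    suff : F --> x by move=> /(_ _ xA)[n _ nA]; exists n.
    apply/cvg_sup => i B [_ [[C oC <-] Cx CB]].
    exists i.+1 => // y xy; apply: CB.
    by rewrite /preimage /= -(xy i).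
  apply: filterS nA _; elim: n => [|n IH].
    exact: filterS (@filterT _ _ _).
  have nx : nbhs x [set y : cantor_space | x n = y n].
    have xn : nbhs (x n : bool) [set b | x n = b].
      by apply: open_nbhs_nbhs; split=> //; apply: discrete_open.
    exact: (@proj_continuous nat (fun=> bool) n x _ xn).
  apply: filterS (filterI IH nx) => y [xy xn] i.
  by rewrite ltnS leq_eqVlt => /predU1P[->//|/xy].
(* Diagonal limit: coordinate [i] no longer changes from [u i.+1] on. *)
- move=> u uP; exists (fun i => u i.+1 i) => n i ni.
  rewrite -(subnK ni); elim: (n - i.+1) => // k IH.
  by rewrite addSn -uP // leq_addl.
- move=> n; exists (fun x => pickle [seq x i | i <- iota 0 n]).
  move=> x y /(pcan_inj pickleK)/eq_in_map xy i ni.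
  by apply: xy; rewrite mem_iota.
Qed.

Theorem corollary3p2 (R : realType) :
  Gdelta (essentially_minimal_homeos cantor_space) /\
  polish R (essentially_minimal_homeos cantor_space).
Proof.
have cC := cantor_space_compact.
have GE := essentially_minimal_homeos_Gdelta cantor_ultra_base cC (fun=> false).
split=> //.
have [e' eE] := ub_Gdelta (ub_Aut cantor_ultra_base cC) GE.
exact: ub_polish eE.
Qed.
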